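(* Let $m\ge n\ge 1$, let $A\in\mathbb{R}^{m\times m}$ be symmetric positive definite and let $Z\in\mathbb{R}^{m\times n}$ have full column rank. In exact arithmetic, the algorithm MGS-HP(col) applied to $Z$ and $A$ produces the same $Q$ and $R$ as the column-oriented modified Gram-Schmidt algorithm MGS(col) with the $A$-inner product (so that $Z=QR$ and $Q^{\rm T}AQ=I_n$). It uses $A$ only through the single matrix-matrix product $AZ$, and its computational cost is $n$ matrix-vector multiplications with $A$ (all performed together in forming $AZ$) plus $3mn^2$ further floating-point operations (leading-order count).
   Context: For an spd matrix $A$, $(\boldsymbol x,\boldsymbol y)_A := \boldsymbol x^{\rm T}A\boldsymbol y$ and $\|\boldsymbol x\|_A:=\sqrt{\boldsymbol x^{\rm T}A\boldsymbol x}$. In both algorithms $Z=[\boldsymbol z_1^{(0)},\dots,\boldsymbol z_n^{(0)}]$, the output is $Q=[\boldsymbol q_1,\dots,\boldsymbol q_n]$ and the upper triangular $R=(r_{ij})$ with $r_{ij}=0$ for $i>j$. MGS(col): for $j=1,\dots,n$: for $i=1,\dots,j-1$ set $r_{ij}=(\boldsymbol q_i,\boldsymbol z_j^{(i-1)})_A$ and $\boldsymbol z_j^{(i)}=\boldsymbol z_j^{(i-1)}-r_{ij}\boldsymbol q_i$; then set $r_{jj}=\|\boldsymbol z_j^{(j-1)}\|_A$ and $\boldsymbol q_j=\boldsymbol z_j^{(j-1)}/r_{jj}$. MGS-HP(col): first compute $X=[\boldsymbol x_1^{(0)},\dots,\boldsymbol x_n^{(0)}]=AZ$. Then for $j=1,\dots,n$: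 for $i=1,\dots,j-1$ set $r_{ij}=\boldsymbol p_i^{\rm T}\boldsymbol z_j^{(i-1)}$ and $\boldsymbol z_j^{(i)}=\boldsymbol z_j^{(i-1)}-r_{ij}\boldsymbol q_i$; then set $\boldsymbol x_j^{(j-1)}=\boldsymbol x_j^{(0)}-\sum_{i=1}^{j-1}r_{ij}\boldsymbol p_i$, $r_{jj}=\sqrt{(\boldsymbol z_j^{(j-1)})^{\rm T}\boldsymbol x_j^{(j-1)}}$, $\boldsymbol q_j=\boldsymbol z_j^{(j-1)}/r_{jj}$ and $\boldsymbol p_j=\boldsymbol x_j^{(j-1)}/r_{jj}$. Floating-point operations are scalar additions, subtractions, multiplications, divisions and square roots. ''$3mn^2$ (leading-order count)'' means that only the leading term is kept: terms of order $O(mn+n^2)$ are dropped. *)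

(* Defs.v *)
From HB Require Import structures.
From mathcomp Require Import all_boot all_order all_algebra.
From mathcomp Require Import reals.

Set Implicit Arguments.
Unset Strict Implicit.
Unset Printing Implicit Defensive.

Import Order.TTheory GRing.Theory Num.Theory.
Local Open Scope ring_scope.

Section InnerProduct.
Variables (R : realType) (m : nat).
Implicit Types (A : 'M[R]_m) (x y : 'cV[R]_m).

Definition spd A : Prop :=
  A^T = A /\ forall x, x != 0 -> 0 < (x^T *m A *m x) 0 0.

Definition innerA A x y : R := (x^T *m A *m y) 0 0.

Definition normA A x : R := Num.sqrt (innerA A x x).

End InnerProduct.

Definition set_entry (V : Type) (a b : nat) (M : 'M[V]_(a, b))
    (i : 'I_a) (j : 'I_b) (v : V) : 'M[V]_(a, b) :=
  \matrix_(k, l) if (k == i) && (l == j) then v else M k l.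

Definition set_col (V : Type) (a b : nat) (M : 'M[V]_(a, b))
    (j : 'I_b) (v : 'cV[V]_a) : 'M[V]_(a, b) :=
  \matrix_(k, l) if l == j then v k 0 else M k l.

(* [enum 'I_n] is increasing, so these are the indices i < j in order. *)
Definition before (n : nat) (j : 'I_n) : seq 'I_n :=
  [seq i : 'I_n <- enum 'I_n | (i < j)%N].

(* MGS(col) in exact arithmetic.  The state is (Q, R), both initially zero; [z]
   runs through z_j^(0), ..., z_j^(j-1).  Since 0^-1 = 0 and [Num.sqrt] is 0 on
   negative reals, a breakdown at step j gives q_j = 0; hence Q^T A Q = I entails
   that every r_jj is positive. *)
Section MGS.
Variables (R : realType) (m n : nat) (A : 'M[R]_m) (Z : 'M[R]_(m, n)).

Definition mgs_inner (Q : 'M[R]_(m, n)) (j : 'I_n)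
    (s : 'cV[R]_m * 'M[R]_n) (i : 'I_n) : 'cV[R]_m * 'M[R]_n :=
  let: (z, T) := s in
  let r := innerA A (col i Q) z in
  (z - r *: col i Q, set_entry T i j r).

Definition mgs_outer (s : 'M[R]_(m, n) * 'M[R]_n) (j : 'I_n) :
    'M[R]_(m, n) * 'M[R]_n :=
  let: (Q, T) := s in
  let: (z, T') := foldl (mgs_inner Q j) (col j Z, T) (before j) in
  let r := normA A z in
  (set_col Q j (r^-1 *: z), set_entry T' j j r).

Definition mgs_col : 'M[R]_(m, n) * 'M[R]_n :=
  foldl mgs_outer (0, 0) (enum 'I_n).

End MGS.

(* Straight-line programs over scalars of an abstract type [V].  A program that
   is polymorphic in [V] can compute with scalars only through the constructors
   below, and can reach the m x m matrix A only through [MulA], which multiplies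
   A by a block of k vectors.  [Zero] is the literal 0. *)
Inductive binop := Add | Sub | Mul | Div.

Inductive prog (m : nat) (V X : Type) : Type :=
| Ret of X
| Zero of (V -> prog m V X)
| Binop of binop & V & V & (V -> prog m V X)
| Sqrt of V & (V -> prog m V X)
| MulA k of 'M[V]_(m, k) & ('M[V]_(m, k) -> prog m V X).

Arguments Ret {m V X}.
Arguments Zero {m V X}.
Arguments Binop {m V X}.
Arguments Sqrt {m V X}.
Arguments MulA {m V X k}.

Fixpoint bind (m : nat) (V X Y : Type) (p : prog m V X)
    (f : X -> prog m V Y) {struct p} : prog m V Y :=
  match p with
  | Ret x => f x
  | Zero c => Zero (fun v => bind (c v) f)
  | Binop o a b c => Binop o a b (fun v => bind (c v) f)
  | Sqrt a c => Sqrt a (fun v => bind (c v) f)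
  | MulA k B c => MulA B (fun W => bind (c W) f)
  end.

Notation "'let*' x ':=' p 'in' q" := (bind p (fun x => q))
  (at level 200, x pattern, p at level 200, q at level 200,
   format "'[v' 'let*'  x  ':='  p  'in' '/' q ']'").

Section Semantics.
Variables (R : realType) (m : nat) (A : 'M[R]_m).

Definition eval_binop (o : binop) (a b : R) : R :=
  match o with
  | Add => a + b
  | Sub => a - b
  | Mul => a * b
  | Div => a / b
  end.

Fixpoint eval (X : Type) (p : prog m R X) : X :=
  match p with
  | Ret x => x
  | Zero c => eval (c 0)
  | Binop o a b c => eval (c (eval_binop o a b))
  | Sqrt a c => eval (c (Num.sqrt a))
  | MulA k B c => eval (c (A *m B))
  end.

(* Number of scalar operations, those inside the products with A excluded. *)
Fixpoint flops (X : Type) (p : prog m R X) : nat :=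
  match p with
  | Ret _ => 0
  | Zero c => flops (c 0)
  | Binop o a b c => (flops (c (eval_binop o a b))).+1
  | Sqrt a c => (flops (c (Num.sqrt a))).+1
  | MulA k B c => flops (c (A *m B))
  end.

(* The blocks that A is multiplied by, in order, each with its width. *)
Fixpoint products (X : Type) (p : prog m R X) : seq {k : nat & 'M[R]_(m, k)} :=
  match p with
  | Ret _ => [::]
  | Zero c => products (c 0)
  | Binop o a b c => products (c (eval_binop o a b))
  | Sqrt a c => products (c (Num.sqrt a))
  | MulA k B c =>
      existT (fun l => 'M[R]_(m, l)) k B :: products (c (A *m B))
  end.

(* A product with a block of k columns is k matrix-vector multiplications. *)
Definition matvecs (X : Type) (p : prog m R X) : nat :=
  (\sum_(B <- products p) projT1 B)%N.

End Semantics.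

Section Programs.
Variables (m : nat) (V : Type).

Definition zero : prog m V V := Zero Ret.
Definition binary (o : binop) (a b : V) : prog m V V := Binop o a b Ret.
Definition squareroot (a : V) : prog m V V := Sqrt a Ret.
Definition multA (k : nat) (B : 'M[V]_(m, k)) : prog m V 'M[V]_(m, k) :=
  MulA B Ret.

Fixpoint loop (I S : Type) (body : S -> I -> prog m V S) (s : S) (r : seq I) :
    prog m V S :=
  if r is i :: r' then let* s' := body s i in loop body s' r' else Ret s.

(* a_1 b_1 + ... + a_k b_k, using k multiplications and k - 1 additions. *)
Definition dot (r : seq (V * V)) : prog m V V :=
  if r is (a, b) :: r' then
    let* t := binary Mul a b in
    loop (fun acc ab => let* u := binary Mul ab.1 ab.2 in binary Add acc u) t r'
  else zero.

Definition dot_cV (u v : 'cV[V]_m) : prog m V V :=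
  dot [seq (u k 0, v k 0) | k <- enum 'I_m].

(* Overwrites every entry [v k 0] by the result of [f k (v k 0)]. *)
Definition update (f : 'I_m -> V -> prog m V V) (v : 'cV[V]_m) :
    prog m V 'cV[V]_m :=
  loop (fun (w : 'cV[V]_m) k => let* t := f k (w k 0) in Ret (set_entry w k 0 t))
       v (enum 'I_m).

End Programs.

Section MGS_HP.
Variables (V : Type) (m n : nat) (Z : 'M[V]_(m, n)).

Definition mgs_hp_inner (Q P : 'M[V]_(m, n)) (j : 'I_n)
    (s : 'cV[V]_m * 'M[V]_n) (i : 'I_n) : prog m V ('cV[V]_m * 'M[V]_n) :=
  let: (z, T) := s in
  let* r := dot_cV (col i P) z in
  let* z' := update (fun k zk =>
    let* t := binary m Mul r (Q k i) in binary m Sub zk t) z in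
  Ret (z', set_entry T i j r).

Definition mgs_hp_outer (X : 'M[V]_(m, n))
    (s : 'M[V]_(m, n) * 'M[V]_(m, n) * 'M[V]_n) (j : 'I_n) :
    prog m V ('M[V]_(m, n) * 'M[V]_(m, n) * 'M[V]_n) :=
  let: (Q, P, T) := s in
  let* zT := loop (mgs_hp_inner Q P j) (col j Z, T) (before j) in
  let: (z, T') := zT in
  let* x := update (fun k xk =>
    let* t := dot m [seq (T' i j, P k i) | i <- before j] in
    binary m Sub xk t) (col j X) in
  let* d := dot_cV z x in
  let* r := squareroot m d in
  let* q := update (fun _ zk => binary m Div zk r) z in
  let* p := update (fun _ xk => binary m Div xk r) x in
  Ret (set_col Q j q, set_col P j p, set_entry T' j j r).

Definition mgs_hp_col : prog m V ('M[V]_(m, n) * 'M[V]_n) :=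
  let* X := multA Z in
  let* o := zero m V in
  let* QPT := loop (mgs_hp_outer X)
    (const_mx o, const_mx o, const_mx o) (enum 'I_n) in
  let: (Q, _, T) := QPT in
  Ret (Q, T).

End MGS_HP.

(* Main.v *)
Require Import Defs.
From HB Require Import structures.
From mathcomp Require Import all_boot all_order all_algebra.
From mathcomp Require Import reals.
From mathcomp Require Import zify.

Set Implicit Arguments.
Unset Strict Implicit.
Unset Printing Implicit Defensive.

Import Order.TTheory GRing.Theory Num.Theory.
Local Open Scope ring_scope.

(* MGS-HP(col) keeps P = A Q: since A is symmetric, p_i^T z = (q_i, z)_A, and by
   linearity x_j^(j-1) = A z_j^(j-1).  Hence each of its steps computes exactly
   what MGS(col) computes, breakdowns included.  Step j (counted from 0) costs
   (4m - 1) j operations for the projections, 2mj for x_j (m if j = 0), and 4m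
   for the normalization, which sums to 3mn^2 + mn + m - n(n-1)/2. *)

(** * Results, operation counts and products with [A] for the program combinators *)

Section Programs.
Variables (R : realType) (m : nat) (A : 'M[R]_m).

Lemma eval_bind (X Y : Type) (p : prog m R X) (f : X -> prog m R Y) :
  eval A (bind p f) = eval A (f (eval A p)).
Proof. by elim: p => //=. Qed.

Lemma flops_bind (X Y : Type) (p : prog m R X) (f : X -> prog m R Y) :
  flops A (bind p f) = (flops A p + flops A (f (eval A p)))%N.
Proof. by elim: p => //= [o a b c IH|a c IH]; rewrite IH addSn. Qed.

Lemma products_bind (X Y : Type) (p : prog m R X) (f : X -> prog m R Y) :
  products A (bind p f) = products A p ++ products A (f (eval A p)).
Proof. by elim: p => //= k B c ->. Qed.

Lemma eval_loop (I S : Type) (body : S -> I -> prog m R S) s r :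
  eval A (loop body s r) = foldl (fun s i => eval A (body s i)) s r.
Proof. by elim: r s => //= i r IH s; rewrite eval_bind IH. Qed.

Lemma flops_loop (I S : Type) (body : S -> I -> prog m R S) (c : I -> nat) s r :
  (forall s i, flops A (body s i) = c i) ->
  flops A (loop body s r) = (\sum_(i <- r) c i)%N.
Proof.
move=> fc; elim: r s => [|i r IH] s /=; first by rewrite big_nil.
by rewrite flops_bind fc IH big_cons.
Qed.

Lemma products_loop (I S : Type) (body : S -> I -> prog m R S) s r :
  (forall s i, products A (body s i) = [::]) ->
  products A (loop body s r) = [::].
Proof.
by move=> pc; elim: r s => //= i r IH s; rewrite products_bind pc IH.
Qed.

Lemma eval_dot (r : seq (R * R)) :
  eval A (dot m r) = \sum_(ab <- r) ab.1 * ab.2.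
Proof.
case: r => [|[a b] r] /=; first by rewrite big_nil.
rewrite big_cons /=; move: (a * b) => t.
elim: r t => [|ab r IH] t /=; first by rewrite big_nil addr0.
by rewrite IH big_cons addrA.
Qed.

(** The truncated predecessor also covers the empty list: [zero] is a literal and costs nothing. *)
Lemma flops_dot (r : seq (R * R)) : flops A (dot m r) = ((size r).*2.-1)%N.
Proof.
case: r => [|[a b] r] //=; rewrite (@flops_loop _ _ _ (fun=> 2)) //.
by rewrite big_const_seq count_predT iter_addn_0 mul2n.
Qed.

Lemma products_dot (r : seq (R * R)) : products A (dot m r) = [::].
Proof. by case: r => [|[a b] r] //=; rewrite products_loop. Qed.

Lemma eval_dot_cV (u v : 'cV[R]_m) : eval A (dot_cV u v) = (u^T *m v) 0 0.
Proof.
rewrite /dot_cV eval_dot big_map big_enum mxE.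
by apply: eq_bigr => k _; rewrite mxE.
Qed.

Lemma flops_dot_cV (u v : 'cV[R]_m) : flops A (dot_cV u v) = (m.*2.-1)%N.
Proof. by rewrite /dot_cV flops_dot size_map size_enum_ord. Qed.

Lemma eval_update (f : 'I_m -> R -> prog m R R) (v : 'cV[R]_m) :
  eval A (update f v) = \col_k eval A (f k (v k 0)).
Proof.
rewrite /update eval_loop; set g := (X in foldl X).
have gE w k : g w k = set_entry w k 0 (eval A (f k (w k 0))).
  by rewrite /g eval_bind.
(* A duplicate-free list visits each entry at most once, so [f k] always reads the original
   entry. *)
have H r : uniq r -> forall w, foldl g w r =
    \col_k (if k \in r then eval A (f k (w k 0)) else w k 0).
  elim: r => [|i r IH] /=; first by move=> _ w; apply/colP => k; rewrite mxE.
  case/andP=> ir ur w; rewrite IH //; apply/colP => k; rewrite gE !mxE inE andbT.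
  by have [->|//] := eqVneq k i; rewrite (negPf ir).
by rewrite H ?enum_uniq //; apply/colP => k; rewrite !mxE mem_enum.
Qed.

Lemma flops_update (f : 'I_m -> R -> prog m R R) (v : 'cV[R]_m) c :
  (forall k x, flops A (f k x) = c) -> flops A (update f v) = (m * c)%N.
Proof.
move=> fc; rewrite /update (@flops_loop _ _ _ (fun=> c)) => [|s i].
  by rewrite big_enum /= sum_nat_const card_ord.
by rewrite flops_bind fc addn0.
Qed.

Lemma products_update (f : 'I_m -> R -> prog m R R) (v : 'cV[R]_m) :
  (forall k x, products A (f k x) = [::]) -> products A (update f v) = [::].
Proof.
by move=> pc; rewrite /update products_loop // => s i; rewrite products_bind pc.
Qed.

End Programs.

(** * Folds over prefixes and the order of the column indices *)

(** Loop invariants may depend on the prefix already processed; the decomposition of [r] lets a step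
    identify that prefix with [before j]. *)
Lemma foldl_prefix_ind (S T : Type) (P : seq T -> S -> Prop) (f : S -> T -> S)
    (s : S) (r : seq T) :
  P [::] s ->
  (forall p j q u, r = p ++ j :: q -> P p u -> P (rcons p j) (f u j)) ->
  P r (foldl f s r).
Proof.
move=> P0 PS.
suff H q p u : r = p ++ q -> P p u -> P r (foldl f u q) by exact: (H r [::]).
elim: q p u => [|j q IH] p u rE Pp /=; first by rewrite rE cats0.
by apply: IH (PS _ _ _ _ rE Pp); rewrite cat_rcons.
Qed.

Lemma before_split (n : nat) (p q : seq 'I_n) (j : 'I_n) :
  enum 'I_n = p ++ j :: q -> before j = p.
Proof.
move=> E.
have : sorted ltn [seq val i | i <- enum 'I_n] by rewrite val_enum_ord iota_ltn_sorted.
(* In pairwise form the strict order splits along the concatenation: [p] lies below [j] and [q]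
   above it. *)
rewrite sorted_pairwise; last exact: ltn_trans.
rewrite E map_cat pairwise_cat allrel_consr /= => /and3P[/andP[pj _] _ /andP[jq _]].
rewrite /before E filter_cat /= ltnn.
move: pj jq; rewrite !all_map => /all_filterP pj /allP jq.
rewrite [X in X ++ _](_ : _ = p) ?[X in p ++ X](_ : _ = [::]) ?cats0 //.
apply/eqP; rewrite -[_ == _]negbK -has_filter; apply/hasPn => i /jq /=.
by rewrite -leqNgt => /ltnW.
Qed.

Lemma size_before (n : nat) (j : 'I_n) : size (before j) = j.
Proof.
rewrite -(size_map val) (_ : map _ _ = iota 0 j) ?size_iota //.
by rewrite -(filter_iota_ltn 0 (ltnW (ltn_ord j))) -val_enum_ord filter_map.
Qed.

(** * Correctness of MGS(col): orthonormality and factorization *)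

Section GramSchmidt.
Variables (R : realType) (m n : nat) (A : 'M[R]_m) (Z : 'M[R]_(m, n)).

Lemma innerA_mul (x y : 'cV[R]_m) : innerA A x y = (x^T *m (A *m y)) 0 0.
Proof. by rewrite /innerA mulmxA. Qed.

Lemma innerABr (x y z : 'cV[R]_m) :
  innerA A x (y - z) = innerA A x y - innerA A x z.
Proof. by rewrite /innerA mulmxBr !mxE. Qed.

Lemma innerAZr (a : R) (x y : 'cV[R]_m) :
  innerA A x (a *: y) = a * innerA A x y.
Proof. by rewrite /innerA -scalemxAr mxE. Qed.

Lemma innerAZl (a : R) (x y : 'cV[R]_m) :
  innerA A (a *: x) y = a * innerA A x y.
Proof. by rewrite /innerA linearZ /= -!scalemxAl mxE. Qed.

Lemma innerAC (x y : 'cV[R]_m) : A^T = A -> innerA A x y = innerA A y x.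
Proof.
move=> sA; rewrite /innerA -[in LHS](trmxK (x^T *m A *m y)) mxE.
by rewrite !trmx_mul trmxK sA mulmxA.
Qed.

Lemma col_set_col (M : 'M[R]_(m, n)) (j k : 'I_n) (v : 'cV[R]_m) :
  col k (set_col M j v) = if k == j then v else col k M.
Proof. by apply/colP => i; rewrite !mxE; case: eqP => // _; rewrite !mxE. Qed.

Lemma mulmx_set_col (M : 'M[R]_(m, n)) (j : 'I_n) (v : 'cV[R]_m) :
  A *m set_col M j v = set_col (A *m M) j (A *m v).
Proof.
apply/matrixP => i k; rewrite !mxE; case: ifP => kj; rewrite ?mxE;
  by apply: eq_bigr => l _; rewrite !mxE kj.
Qed.

(** Each step removes the component along one [col i Q], and orthogonality keeps the earlier inner
    products zero. Orthonormality is assumed in the last clause only, so that the first one remains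
    available after a breakdown. *)
Lemma mgs_inner_spec (Q : 'M[R]_(m, n)) (j : 'I_n) (z0 : 'cV[R]_m) (T : 'M[R]_n)
    (r : seq 'I_n) :
  uniq r ->
  let: (z, T') := foldl (mgs_inner A Q j) (z0, T) r in
  [/\ z = z0 - \sum_(i <- r) T' i j *: col i Q,
      forall k l, (k \notin r) || (l != j) -> T' k l = T k l &
      {in r &, forall i k, innerA A (col i Q) (col k Q) = (i == k)%:R} ->
      {in r, forall i, innerA A (col i Q) z = 0}].
Proof.
elim/last_ind: r => [_|r i IH] /=; first by rewrite big_nil subr0.
rewrite rcons_uniq foldl_rcons => /andP[ir ur]; have := IH ur.
case: (foldl _ _ r) => z T' [zE TE zO] /=.
set c := innerA A (col i Q) z; split.
- rewrite big_rcons /= {1}zE mxE !eqxx -addrA -opprD; congr (_ - (_ + _)).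
  (* Since [i] is not in [r], writing entry [(i, j)] leaves the earlier coefficients intact. *)
  apply: eq_big_seq => k kr; rewrite mxE.
  by case: eqP kr ir => [->->|].
- move=> k l; rewrite mxE mem_rcons inE; have [->|ki] := eqVneq k i.
    by rewrite /= => lj; rewrite (negPf lj) TE // lj orbT.
  by move=> kl; rewrite TE.
- move=> QO k; rewrite mem_rcons inE innerABr innerAZr => kr.
  rewrite QO ?mem_rcons ?inE ?eqxx //.
  case/orP: kr => [/eqP->|kr]; first by rewrite eqxx mulr1 subrr.
  rewrite zO // => [|a b ar br]; last by rewrite QO // mem_rcons inE ?ar ?br orbT.
  by case: eqP kr ir => [->->//|_ _ _]; rewrite mulr0 subrr.
Qed.

(* In the last clause q_k is a combination of the z_i already processed.  So
   z_j^(j-1) is Z c with c_j = 1, and full column rank makes it nonzero. *)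
Definition mgs_invariant (p : seq 'I_n) (s : 'M[R]_(m, n) * 'M[R]_n) : Prop :=
  let: (Q, T) := s in
  [/\ {in p &, forall i k, innerA A (col i Q) (col k Q) = (i == k)%:R},
      {in p, forall k, col k Z = \sum_(i <- p) T i k *: col i Q},
      forall i k, i \notin p -> T i k = 0 &
      {in p, forall k, exists2 c : 'cV[R]_n,
         col k Q = Z *m c & forall i, i \notin p -> c i 0 = 0}].

Lemma mgs_colP : spd A -> \rank Z = n -> mgs_invariant (enum 'I_n) (mgs_col A Z).
Proof.
move=> [sA pA] rZ; apply: foldl_prefix_ind => [|p j q [Q T] E].
  by split=> // i k; rewrite mxE.
case=> QO ZE T0 QZ; rewrite /= (before_split E).
have : uniq (rcons p j).
  have := enum_uniq 'I_n; rewrite E -cat_rcons cat_uniq; by case/andP.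
rewrite rcons_uniq => /andP[jp up].
have := mgs_inner_spec Q j (col j Z) T up.
case: (foldl _ _ p) => z T' [zE TE /(_ QO) zO] /=.
have [c zc [cj c0]] : exists2 c : 'cV[R]_n, z = Z *m c &
    c j 0 = 1 /\ forall i, i \notin rcons p j -> c i 0 = 0.
  (* Vectors [Z *m d] with [d] supported on [p] are closed under sums and scaling, so they contain
     everything the projections subtract. *)
  have [d dE d0] : exists2 d : 'cV[R]_n,
      \sum_(i <- p) T' i j *: col i Q = Z *m d & forall i, i \notin p -> d i 0 = 0.
    rewrite big_seq; apply: (big_ind (fun v => exists2 d : 'cV[R]_n,
      v = Z *m d & forall i, i \notin p -> d i 0 = 0)).
    - by exists 0; rewrite ?mulmx0 // => i _; rewrite mxE.
    - move=> _ _ [d1 -> h1] [d2 -> h2]; exists (d1 + d2); rewrite ?mulmxDr //.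
      by move=> i ip; rewrite mxE h1 // h2 // addr0.
    - move=> i /QZ[d -> h]; exists (T' i j *: d); rewrite ?scalemxAr //.
      by move=> k kp; rewrite mxE h // mulr0.
  exists (delta_mx j 0 - d); first by rewrite mulmxBr -colE -dE.
  split; first by rewrite !mxE !eqxx d0 // subr0.
  move=> i; rewrite mem_rcons inE negb_or => /andP[ij ip].
  by rewrite !mxE (negPf ij) d0 // subr0.
(* Full column rank makes [Z] injective, so [z = 0] would force [c = 0], against [c j 0 = 1]. *)
have zn0 : z != 0.
  apply: contra_eq_neq cj => z0; have : Z *m c = 0 by rewrite -zc.
  move/(congr1 trmx); rewrite trmx_mul trmx0.
  have fZ : row_free Z^T by rewrite /row_free mxrank_tr rZ.
  rewrite -(mul0mx _ Z^T) => /(row_free_inj fZ) /(congr1 trmx).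
  by rewrite trmxK trmx0 => ->; rewrite mxE eq_sym oner_neq0.
have zz : 0 < innerA A z z by exact: pA.
set t := normA A z.
have t0 : t != 0 by rewrite /t /normA sqrtr_eq0 -ltNge.
have tt : t * t = innerA A z z by rewrite -expr2 sqr_sqrtr // ltW.
have pj i : i \in p -> i == j = false by case: eqP jp => // -> /negPf->.
split.
(* The new column has norm 1 by [tt]; both mixed cases reduce to [zO], one of them through symmetry
   of the inner product. *)
- move=> i k; rewrite !mem_rcons !inE !col_set_col.
  case: (eqVneq i j) => [->|ij] /=; case: (eqVneq k j) => [->|kj] //= ip kp.
  + by rewrite innerAZl innerAZr -tt mulKf // mulVf // eqxx.
  + by rewrite innerAZl innerAC // zO // mulr0.
  + by rewrite innerAZr zO // mulr0 (negPf ij).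
  + by rewrite QO.
- move=> k; rewrite mem_rcons inE big_rcons col_set_col eqxx mxE eqxx /=.
  case: (eqVneq k j) => [->|kj] /= kp.
    (* For the new column, the diagonal term gives back [z], and the other terms restore what the
       projections removed. *)
    rewrite scalerA mulfV // scale1r.
    rewrite [X in _ = X + _](_ : _ = \sum_(i <- p) T' i j *: col i Q).
      by rewrite zE subrKC.
    by apply: eq_big_seq => i ip; rewrite col_set_col mxE pj.
  (* For an older column [k] the additional term vanishes: row [j] of [T] is still zero there. *)
  rewrite TE ?kj ?orbT // T0 // scale0r addr0 ZE //.
  by apply: eq_big_seq => i ip; rewrite col_set_col mxE pj // TE // kj orbT.
- move=> i k; rewrite mem_rcons inE negb_or => /andP[ij ip].
  by rewrite mxE (negPf ij) /= TE ?ip // T0.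
- move=> k; rewrite mem_rcons inE col_set_col; case: (eqVneq k j) => [->|kj] /= kp.
    exists (t^-1 *: c); first by rewrite zc scalemxAr.
    by move=> i ip; rewrite mxE c0 // mulr0.
  have [d dE d0] := QZ k kp; exists d => // i.
  by rewrite mem_rcons inE negb_or => /andP[_ /d0].
Qed.

Lemma mgs_col_QR : spd A -> \rank Z = n ->
  let: (Q, T) := mgs_col A Z in Z = Q *m T /\ Q^T *m A *m Q = 1%:M.
Proof.
move=> sA rZ; have := mgs_colP sA rZ; case: (mgs_col A Z) => Q T [QO ZE _ _].
split; apply/matrixP => i k.
  have /colP/(_ i) := ZE k (mem_enum _ k).
  rewrite !mxE => ->; rewrite big_enum summxE.
  by apply: eq_bigr => l _; rewrite !mxE mulrC.
rewrite [RHS]mxE -QO ?mem_enum //.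
rewrite /innerA -!mulmxA !mxE; apply: eq_bigr => l _.
by rewrite !mxE; congr (_ * _); apply: eq_bigr => h _; rewrite mxE.
Qed.

(** * Step-by-step agreement of MGS-HP(col) with MGS(col) *)

Hypothesis sA : A^T = A.

Lemma eval_mgs_hp_inner (Q : 'M[R]_(m, n)) (j : 'I_n) s i :
  eval A (mgs_hp_inner Q (A *m Q) j s i) = mgs_inner A Q j s i.
Proof.
case: s => z T; rewrite /mgs_hp_inner !eval_bind /= eval_dot_cV eval_update.
have -> : ((col i (A *m Q))^T *m z) 0 0 = innerA A (col i Q) z.
  by rewrite /innerA !colE -mulmxA trmx_mul sA.
by congr pair; apply/colP => k; rewrite !mxE.
Qed.

(** The state has the form [(Q, A *m Q, T)] before and after the step, so the steps chain without
    any orthonormality assumption. *)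
Lemma eval_mgs_hp_outer (Q : 'M[R]_(m, n)) (T : 'M[R]_n) (j : 'I_n) :
  eval A (mgs_hp_outer Z (A *m Z) (Q, A *m Q, T) j) =
  let: (Q', T') := mgs_outer A Z (Q, T) j in (Q', A *m Q', T').
Proof.
rewrite /= eval_bind eval_loop.
have foldlE s r : foldl (fun s i => eval A (mgs_hp_inner Q (A *m Q) j s i)) s r =
    foldl (mgs_inner A Q j) s r.
  by elim: r s => //= i r IH s; rewrite eval_mgs_hp_inner IH.
rewrite {}foldlE.
have ub : uniq (before j) by rewrite filter_uniq ?enum_uniq.
have := mgs_inner_spec Q j (col j Z) T ub.
case: (foldl _ _ (before j)) => z T' [zE _ _].
rewrite eval_bind eval_update.
set x := \col_k _.
have xE : x = A *m z.
  apply/colP => k; rewrite /x mxE eval_bind eval_dot big_map /=.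
  rewrite zE mulmxBr mulmx_sumr !colE mulmxA !mxE; congr (_ - _).
  rewrite summxE; apply: eq_bigr => i _.
  by rewrite -scalemxAr colE mulmxA -colE !mxE.
(* With [x = A *m z], the computed dot product of [z] and [x] is [innerA A z z], so its root is
   [normA A z]. *)
rewrite {x}xE eval_bind eval_dot_cV /= !eval_bind /= !eval_update -innerA_mul -/(normA A z).
have divE (v : 'cV[R]_m) a : \col_k (v k 0 / a) = a^-1 *: v.
  by apply/colP => k; rewrite !mxE mulrC.
by rewrite !divE mulmx_set_col -scalemxAr.
Qed.

Lemma eval_mgs_hp_col : eval A (mgs_hp_col Z) = mgs_col A Z.
Proof.
rewrite /mgs_hp_col /= eval_bind eval_loop /mgs_col.
(* The zero initial state satisfies [P = A *m Q]. *)
have -> : (const_mx 0, const_mx 0, const_mx 0) =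
   (0 : 'M[R]_(m, n), A *m (0 : 'M[R]_(m, n)), 0 : 'M[R]_n) by rewrite mulmx0.
move: (0 : 'M[R]_(m, n)) (0 : 'M[R]_n) (enum 'I_n) => Q T r.
elim: r Q T => [|j r IH] Q T //=.
rewrite -/(mgs_hp_outer Z (A *m Z) (Q, A *m Q, T) j) eval_mgs_hp_outer.
rewrite -/(mgs_outer A Z (Q, T) j).
by case: (mgs_outer _ _ _ _) => Q' T'; exact: IH.
Qed.

End GramSchmidt.

(** * Products with [A] and the operation count *)

Section Cost.
Variables (R : realType) (m n : nat) (A : 'M[R]_m) (Z : 'M[R]_(m, n)).

Lemma products_mgs_hp_inner (Q P : 'M[R]_(m, n)) (j : 'I_n) s i :
  products A (mgs_hp_inner Q P j s i) = [::].
Proof.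
by case: s => z T; rewrite /mgs_hp_inner !products_bind products_dot products_update.
Qed.

Lemma products_mgs_hp_outer (X : 'M[R]_(m, n)) s (j : 'I_n) :
  products A (mgs_hp_outer Z X s j) = [::].
Proof.
case: s => [[Q P] T] /=; rewrite products_bind products_loop; last first.
  by move=> *; exact: products_mgs_hp_inner.
case: (eval A _) => z T'; rewrite !products_bind products_dot products_update.
  by rewrite /= !products_bind !products_update.
by move=> k x; rewrite products_bind products_dot.
Qed.

Lemma products_mgs_hp_col :
  products A (mgs_hp_col Z) = [:: existT (fun k => 'M[R]_(m, k)) n Z].
Proof.
rewrite /mgs_hp_col /= products_bind products_loop; last first.
  by move=> *; exact: products_mgs_hp_outer.
by case: (eval A _) => [[Q P] T].
Qed.

Lemma flops_mgs_hp_inner (Q P : 'M[R]_(m, n)) (j : 'I_n) s i :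
  flops A (mgs_hp_inner Q P j s i) = (m.*2.-1 + m * 2)%N.
Proof.
case: s => z T; rewrite /mgs_hp_inner !flops_bind flops_dot_cV.
by rewrite (@flops_update _ _ _ _ _ 2) ?addn0.
Qed.

(** The terms are the [j] projections, the update of [x], the dot product of [z] and [x], one square
    root and two divisions by [r] of [m] entries each. The factor [j.*2.-1.+1] is [2 * j], except
    that it is 1 at [j = 0], where the literal 0 is subtracted. *)
Lemma flops_mgs_hp_outer (X : 'M[R]_(m, n)) s (j : 'I_n) :
  flops A (mgs_hp_outer Z X s j) =
  (j * (m.*2.-1 + m * 2) + (m * j.*2.-1.+1 + (m.*2.-1 + 1 + m + m)))%N.
Proof.
case: s => [[Q P] T] /=; rewrite flops_bind.
rewrite (flops_loop _ _ (flops_mgs_hp_inner Q P j)).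
rewrite big_const_seq count_predT iter_addn_0 size_before mulnC; congr (_ + _)%N.
case: (eval A _) => z T'; rewrite !flops_bind flops_dot_cV.
rewrite (@flops_update _ _ _ _ _ j.*2.-1.+1) => [|k x]; last first.
  by rewrite flops_bind flops_dot size_map size_before addn1.
rewrite /= !flops_bind !(@flops_update _ _ _ _ _ 1) // !muln1 /=.
by rewrite addn0 addn1 addSn !addnS !addnA.
Qed.

Lemma flops_mgs_hp_col : flops A (mgs_hp_col Z) =
  (\sum_(j < n)
     (j * (m.*2.-1 + m * 2) + (m * j.*2.-1.+1 + (m.*2.-1 + 1 + m + m))))%N.
Proof.
rewrite /mgs_hp_col /= flops_bind (flops_loop _ _ (flops_mgs_hp_outer _)).
by case: (eval A _) => [[Q P] T]; rewrite /= addn0 big_enum.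
Qed.

Lemma flops_mgs_hp_col_bounds : (0 < m)%N ->
  (3 * m * n ^ 2 <= flops A (mgs_hp_col Z) + 2 * (m * n + n ^ 2))%N /\
  (flops A (mgs_hp_col Z) <= 3 * m * n ^ 2 + 2 * (m * n + n ^ 2))%N.
Proof.
move=> m0; rewrite flops_mgs_hp_col.
(* The induction runs on sharper errors, [n ^ 2] below and [2 * m * n] above; the upper one is
   attained at [n = 1]. *)
suff : (3 * m * n ^ 2 <= \sum_(j < n)
     (j * (m.*2.-1 + m * 2) + (m * j.*2.-1.+1 + (m.*2.-1 + 1 + m + m))) + n ^ 2)%N /\
  (\sum_(j < n)
     (j * (m.*2.-1 + m * 2) + (m * j.*2.-1.+1 + (m.*2.-1 + 1 + m + m)))
     <= 3 * m * n ^ 2 + 2 * m * n)%N by lia.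
elim: n => [|k [lo hi]]; first by rewrite !big_ord0 !muln0.
rewrite big_ord_recr /=; move: (\sum_(_ < _) _)%N lo hi => S lo hi.
(* Adding [k] on the left avoids natural subtraction; the last term on the right accounts for the
   exceptional first column. *)
have costE : (k * (m.*2.-1 + m * 2) + (m * k.*2.-1.+1 + (m.*2.-1 + 1 + m + m))
    + k = 6 * (m * k) + 4 * m + (k == 0) * m)%N.
  case: (m) m0 => // l _.
  have -> : (l.+1.*2.-1 = 2 * l + 1)%N by lia.
  have -> : (k.*2.-1.+1 = 2 * k + (k == 0))%N by case: (k) => // h; lia.
  by case: (k == 0)%N; lia.
(* After these expansions the goal is linear in the monomials [m * k ^ 2], [m * k] and [k ^ 2],
   within reach of [lia]. *)
have kk : (k.+1 ^ 2 = k ^ 2 + 2 * k + 1)%N by rewrite -addn1 sqrnD; lia.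
have mkk : (m * k.+1 ^ 2 = m * k ^ 2 + 2 * (m * k) + m)%N by rewrite kk; lia.
have k0 : ((k == 0) * m <= m)%N by case: (k == 0)%N; lia.
by rewrite -!mulnA mulnS mkk kk in lo hi *; split; lia.
Qed.

End Cost.

Theorem mainTheorem4 (R : realType) :
  exists C : nat,
  forall (m n : nat) (A : 'M[R]_m) (Z : 'M[R]_(m, n)),
    (1 <= n)%N -> (n <= m)%N ->
    spd A -> \rank Z = n ->
    eval A (mgs_hp_col Z) = mgs_col A Z /\
    (forall (Q : 'M[R]_(m, n)) (T : 'M[R]_n),
       eval A (mgs_hp_col Z) = (Q, T) ->
       Z = Q *m T /\ Q^T *m A *m Q = 1%:M) /\
    products A (mgs_hp_col Z) = [:: existT (fun k => 'M[R]_(m, k)) n Z] /\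
    matvecs A (mgs_hp_col Z) = n /\
    (3 * m * n ^ 2 <= flops A (mgs_hp_col Z) + C * (m * n + n ^ 2))%N /\
    (flops A (mgs_hp_col Z) <= 3 * m * n ^ 2 + C * (m * n + n ^ 2))%N.
Proof.
(* The constant 2 is the one in [flops_mgs_hp_col_bounds], where it absorbs the upper error
   [2 * m * n]. *)
exists 2 => m n A Z n1 nm spdA rZ.
have evalE := eval_mgs_hp_col Z spdA.1.
have prodE := products_mgs_hp_col A Z.
have m0 : (0 < m)%N by exact: leq_trans nm.
split=> //; split.
  by move=> Q T; rewrite evalE => E; have := mgs_col_QR spdA rZ; rewrite E.
split=> //; split; first by rewrite /matvecs prodE big_seq1.
exact: flops_mgs_hp_col_bounds.
Qed.
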